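(* In the Brownian setting described in the context, let $g=g(y,z)$ be a function satisfying conditions (H.1)–(H.3) listed in the context, and denote by $u_f(t,x)$ the solution of the partial differential equation $$\frac{\partial u(t,x)}{\partial t}=\frac12\frac{\partial^2u(t,x)}{\partial x^2}+g\Big(u,\frac{\partial u(t,x)}{\partial x}\Big),\qquad u(0,x)=f(x),\qquad t\ge 0.$$ If $g(y,z)$ is nonlinear in $z$, then there is no capacity such that the associated Choquet expectation $C$ satisfies $$u_f(t,x)=C[f(W_t+x)]$$ for all bounded functions $f$ and for all $x$.
   Context: Brownian setting: $(\Omega,\mathcal{F},P)$ is a probability space, $(W_s)_{s\ge0}$ is a standard one-dimensional Brownian motion on it, $\mathcal{F}_s=\sigma\{W_r:0\le r\le s\}$ is the filtration it generates, $T>0$, and $\mathcal{F}_T=\mathcal{F}$. Conditions on $g$, stated for a function $g=g(y,z,t):\mathbf{R}\times\mathbf{R}\times[0,T]\to\mathbf{R}$ (in the claim $g$ does not depend on $t$): (H.1) for all $(y,z)$, $g(y,z,t)$ is continuous in $t$ and $\int_0^T g^2(0,0,t)\,dt<\infty$; (H.2) $g$ is uniformly Lipschitz continuous in $(y,z)$, i.e. there exists a constant $K>0$ such that $|g(y,z,t)-g(y',z',t)|\le K(|y-y'|+|z-z'|)$ for all $y,y',z,z'\in\mathbf{R}$; (H.3) $g(y,0,t)\equiv0$ for all $(y,t)\in\mathbf{R}\times[0,T]$. Capacity: a set function $V:\mathcal{F}\to[0,1]$ with (i) $V(\varnothing)=0$, $V(\Omega)=1$; (ii) if $A,B\in\mathcal{F}$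 and $A\subseteq B$, then $V(A)\le V(B)$; (iii) if $A_n\uparrow A$, then $V(A_n)\uparrow V(A)$ as $n\to\infty$. Choquet expectation of a random variable $\xi\in L^2(\Omega,\mathcal{F},P)$ with respect to a capacity $V$: $C(\xi):=\int_{-\infty}^0(V(\xi\ge t)-1)\,dt+\int_0^\infty V(\xi\ge t)\,dt$. *)

(* Defs.v *)
From mathcomp Require Export all_boot all_order all_algebra.
From mathcomp Require Export all_classical all_reals all_analysis.

Set Implicit Arguments.
Unset Strict Implicit.
Unset Printing Implicit Defensive.

Export Order.TTheory GRing.Theory Num.Theory.
Export numFieldNormedType.Exports.

Local Open Scope classical_set_scope.
Local Open Scope ring_scope.

Section brownian_motion.
Context (R : realType) (d : measure_display) (Omega : measurableType d).

(* sigma {W_r : 0 <= r <= s} *)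
Definition natural_filtration (W : R -> Omega -> R) (s : R) :
    set (set Omega) :=
  <<s [set A | exists2 r, 0 <= r <= s &
        preimage_set_system [set: Omega] (W r) measurable A] >>.

(* Brownian motion on the time interval [0, T]; W r is irrelevant for r outside
   [0, T].  The horizon is needed because the sigma-algebra of Omega is later
   assumed to be generated by the W r, r <= T, which is incompatible with
   nondegenerate increments after T that are measurable and independent of the
   past.  The Gaussian law is only required for s < t, as normal_prob m 0 is not
   a Dirac mass in the library. *)
Record brownian_motion (P : probability Omega R) (T : R)
    (W : R -> Omega -> R) : Prop := BrownianMotion {
  bm_measurable : forall s, 0 <= s <= T -> measurable_fun setT (W s) ;
  bm_start : {ae P, forall w, W 0 w = 0} ;
  bm_continuous : {ae P, forall w, {within `[0, T], continuous (W ^~ w)}} ;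
  bm_independent : forall (n : nat) (tau : nat -> R) (B : nat -> set R),
    0 <= tau 0%N -> nondecreasing_seq tau -> tau n <= T ->
    (forall i, measurable (B i)) ->
    P (\bigcap_(i < n) [set w | B i (W (tau i.+1) w - W (tau i) w)]) =
    (\prod_(i < n) P [set w | B i (W (tau i.+1) w - W (tau i) w)%R])%E ;
  bm_gaussian : forall s t, 0 <= s -> s < t -> t <= T ->
    forall B : set R, measurable B ->
    P [set w | B (W t w - W s w)] = normal_prob 0 (Num.sqrt (t - s)) B }.

End brownian_motion.

Section generator.
Context (R : realType) (T : R).
Implicit Type g : R -> R -> R -> R.

Definition condH1 g : Prop :=
  (forall y z, {within `[0, T], continuous (g y z)}) /\
  (\int[lebesgue_measure]_(t in `[0%R, T]) (g 0 0 t ^+ 2)%:E < +oo)%E.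

Definition condH2 g : Prop :=
  exists2 K : R, 0 < K & forall y y' z z' t, 0 <= t <= T ->
    `|g y z t - g y' z' t| <= K * (`|y - y'| + `|z - z'|).

Definition condH3 g : Prop := forall y t, 0 <= t <= T -> g y 0 t = 0.

End generator.

Definition linear_in_z (R : realType) (g : R -> R -> R) : Prop :=
  forall y, scalar (g y : R^o -> R).

Section capacity.
Context (R : realType) (d : measure_display) (Omega : measurableType d).
Implicit Type V : set Omega -> R.

(* Values of V at non-measurable sets are irrelevant. *)
Record capacity V : Prop := Capacity {
  capacity_range : forall A, measurable A -> 0 <= V A <= 1 ;
  capacity_set0 : V set0 = 0 ;
  capacity_setT : V setT = 1 ;
  capacity_mono : forall A B, measurable A -> measurable B ->
    A `<=` B -> V A <= V B ;
  capacity_cont : forall A : (set Omega)^nat,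
    (forall n, measurable (A n)) -> nondecreasing_seq A ->
    V (A n) @[n --> \oo] --> V (\bigcup_n A n) }.

Definition choquet V (xi : Omega -> R) : \bar R :=
  (\int[lebesgue_measure]_(t in `]-oo, 0%R]) (V [set w | (t <= xi w)%R] - 1)%:E +
   \int[lebesgue_measure]_(t in `[0%R, +oo[) (V [set w | (t <= xi w)%R])%:E)%E.

End capacity.

Section pde.
Context (R : realType).
Implicit Types (u : R -> R -> R) (f : R -> R).

Definition dt u (t x : R) : R := derive1 (u ^~ x) t.
Definition dx u (t x : R) : R := derive1 (u t) x.
Definition dxx u (t x : R) : R := derive1n 2 (u t) x.

Definition jointly_continuous_at (v : R -> R -> R) (t x : R) : Prop :=
  {for (t, x), continuous (fun p : R * R => v p.1 p.2)}.

Record C12_at u (t x : R) : Prop := C12At {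
  C12_derivable_t : derivable (u ^~ x) t 1 ;
  C12_derivable_x : derivable (u t) x 1 ;
  C12_derivable_xx : derivable (derive1 (u t)) x 1 ;
  C12_continuous : jointly_continuous_at u t x ;
  C12_continuous_t : jointly_continuous_at (dt u) t x ;
  C12_continuous_x : jointly_continuous_at (dx u) t x ;
  C12_continuous_xx : jointly_continuous_at (dxx u) t x }.

(* The bounded classical solution of
     u_t = u_xx / 2 + g(u, u_x) for t > 0,   u(0, .) = f,
   for bounded Borel data f.  Boundedness excludes the Tychonoff-type solutions
   that break uniqueness.  For continuous f, sol_continuous0 says that u is
   continuous up to t = 0; for discontinuous f the values u(0, .) = f alone do
   not tie u on t > 0 to f, and sol_ae0 is what restores uniqueness. *)
Record pde_solution (g : R -> R -> R) f u : Prop := PDESolution {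
  sol_bounded : exists M : R, forall t x, 0 <= t -> `|u t x| <= M ;
  sol_regular : forall t x, 0 < t -> C12_at u t x ;
  sol_pde : forall t x, 0 < t ->
    dt u t x = 2^-1 * dxx u t x + g (u t x) (dx u t x) ;
  sol_init : forall x, u 0 x = f x ;
  sol_continuous0 : forall x, {for x, continuous f} ->
    u p.1 p.2 @[p --> within [set p : R * R | 0 <= p.1] (nbhs (0, x))]
      --> f x ;
  sol_ae0 : {ae lebesgue_measure, forall x, u t x @[t --> 0^'+] --> f x} }.

End pde.

(* Main.v *)
Require Import Defs.
From mathcomp Require Import measurable_realfun ring lra.

Set Implicit Arguments.
Unset Strict Implicit.

Local Open Scope classical_set_scope.
Local Open Scope ring_scope.

(** If [u_f] is a Choquet expectation, it is positively homogeneous and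
    translation invariant in [f], so that the equation yields
    [g y (c * z) = c * g y' z] for [c > 0]: on each half-line [z >= 0], [z <= 0]
    the function [g] is linear in [z], with slopes [a] and [b], and it does not
    depend on [y].  Suppose [a != b].

    The indicators of [A = [0, 2]] and of the ray [B = [-s, +oo[], [s >= 0], are
    comonotone since [A] is included in [B], so that
    [u_(1_A + 1_B) = u_1_A + u_1_B]; as [a != b], the slopes of [u_1_A] and
    [u_1_B] cannot have opposite signs.
    For small [t] the slope of [u_1_A] is negative at some [x < 3], hence
    [V (W_t + y >= 0)] is nonincreasing in [y >= x]; since it tends to [1] at
    infinity, [V (W_t + 3 >= 0) = 1].

    Therefore, beyond [3], [u_f] only sees [f] on [[0, +oo[].  For the datum
    [1 - e^(- la x)] on [[0, +oo[], extended by [0], this gives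
    [1 - u t x = e^(- la x) w t], and the equation becomes
    [w' = (la^2 / 2 - a la) w].  The growth of [w] contradicts [u >= 0] as [la]
    goes to infinity. *)

(** * Affine changes of variable in Lebesgue integrals *)

Lemma measurable_affine (R : realType) (c k : R) :
  measurable_fun [set: R] (fun s => c * s + k).
Proof. by apply: measurable_funD => //; exact: measurable_funM. Qed.

(** By uniqueness of the Lebesgue measure: [c] times its pushforward under [c * s + k] has the right
    value on every half-open interval. *)
Lemma lebesgue_measure_affine (R : realType) (c k : R) (A : set R) :
  0 < c -> measurable A ->
  lebesgue_measure A =
  (c%:E * lebesgue_measure ((fun s => c * s + k)%R @^-1` A))%E.
Proof.
move=> c0 mA.
apply: (lebesgue_measure_unique (mu := mscale (NngNum (ltW c0))
  (pushforward lebesgue_measure (fun s : measurableTypeR R =>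
     c * s + k : measurableTypeR R)))) => //.
- move=> mf; exact: measurable_affine.
move=> mf _ [[a b] _ <-].
change (lebesgue_measure `]a, b] =
  c%:E * lebesgue_measure ((fun s => c * s + k)%R @^-1` `]a, b]))%E.
rewrite (_ : _ @^-1` _ = `](a - k) / c, (b - k) / c]%classic); last first.
  apply/seteqP; split => x /=; rewrite !in_itv /=;
    by rewrite ltr_pdivrMr// ler_pdivlMr// ltrBlDr lerBrDr mulrC.
rewrite !lebesgue_measure_itv /= !lte_fin ltr_pM2r ?invr_gt0// ltrD2r.
case: ifPn => ab; last by rewrite mule0.
rewrite -!EFinB -EFinM; congr EFin; field; exact: lt0r_neq0.
Qed.

Lemma ge0_integral_affine (R : realType) (c k : R) (D : set R)
    (h : R -> \bar R) :
  0 < c -> measurable D -> measurable_fun D h -> (forall x, 0 <= h x)%E ->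
  (\int[lebesgue_measure]_(s in D) h s =
   c%:E * \int[lebesgue_measure]_(s in (fun s => c * s + k)%R @^-1` D)
     h (c * s + k)%R)%E.
Proof.
move=> c0 mD mh h0.
pose phi (s : measurableTypeR R) : measurableTypeR R := c * s + k.
have mphi : measurable_fun setT phi by exact: measurable_affine.
rewrite -(ge0_integral_pushforward mphi lebesgue_measure mD mh)//.
have := ge0_integral_mscale (pushforward lebesgue_measure phi) mD
  (NngNum (ltW c0)) mh (fun x _ => h0 x).
move=> /(_ mphi) <-; apply: eq_measure_integral => A mA _.
exact: lebesgue_measure_affine.
Qed.
Lemma ge0_integral_itvU (R : realType) (a x b : itv_bound R) (h : R -> \bar R) :
  (a <= x)%O -> (x <= b)%O -> measurable_fun setT h -> (forall s, 0 <= h s)%E ->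
  (\int[lebesgue_measure]_(s in [set` Interval a b]) h s =
   \int[lebesgue_measure]_(s in [set` Interval a x]) h s +
   \int[lebesgue_measure]_(s in [set` Interval x b]) h s)%E.
Proof.
move=> ax xb mh h0; rewrite (itv_bndbnd_setU ax xb).
apply: ge0_integral_setU => //; first exact: measurable_funTS.
apply/disj_setPS => s [/=]; rewrite !itv_boundlr => /andP[_ sx] /andP[xs _].
by have := le_trans sx xs; rewrite bnd_simp ltxx.
Qed.

(** * Choquet integrals of random variables bounded below *)

Section choquet_integral.
Context (R : realType) (d : measure_display) (Omega : measurableType d).
Context (V : set Omega -> R) (capV : capacity V).
Implicit Types (A B : set Omega) (xi : Omega -> R) (m : R).

Lemma measurable_superlevel xi (t : R) :
  measurable_fun setT xi -> measurable [set w | t <= xi w].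
Proof.
by move=> mxi; rewrite -preimage_itvcy -[X in measurable X]setTI; exact: mxi.
Qed.

Lemma superlevel_measurable xi : measurable_fun setT xi ->
  measurable_fun setT (fun t : R => V [set w | t <= xi w]).
Proof.
move=> mxi; apply: nonincreasing_measurable => // s t st.
apply: (capacity_mono capV) => [||w /=]; last exact: le_trans.
- exact: measurable_superlevel.
- exact: measurable_superlevel.
Qed.

Lemma superlevel_ge0 xi (t : R) : measurable_fun setT xi ->
  0 <= V [set w | t <= xi w].
Proof.
by move=> /measurable_superlevel mxi; have /andP[] := capacity_range capV (mxi t).
Qed.

Lemma superlevel_le1 xi (t : R) : measurable_fun setT xi ->
  V [set w | t <= xi w] <= 1.
Proof.
by move=> /measurable_superlevel mxi; have /andP[] := capacity_range capV (mxi t).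
Qed.

Lemma superlevel_lb xi m (t : R) : (forall w, m <= xi w) -> t <= m ->
  V [set w | t <= xi w] = 1.
Proof.
move=> lb tm; rewrite -(capacity_setT capV); congr V.
by apply/seteqP; split => // w _; exact: le_trans (lb w).
Qed.

(** Below [m] the level function is constantly [1], so moving the cut of the Choquet integral from
    [0] to [m] costs exactly [m]. What remains is a single integral of a nonnegative function,
    possibly infinite. *)
Lemma choquet_lb xi m : measurable_fun setT xi -> (forall w, m <= xi w) ->
  choquet V xi = (m%:E +
    \int[lebesgue_measure]_(t in `[m, +oo[) (V [set w | (t <= xi w)%R])%:E)%E.
Proof.
move=> mxi lb; pose G (t : R) := V [set w | t <= xi w].
have mG : measurable_fun setT (fun t => (G t)%:E).
  by apply/measurable_EFinP; exact: superlevel_measurable.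
have G0 t : (0 <= (G t)%:E)%E by rewrite lee_fin; exact: superlevel_ge0.
have G1 t : 0 <= 1 - G t by rewrite subr_ge0; exact: superlevel_le1.
have mG1 : measurable_fun setT (fun t => (1 - G t)%:E).
  apply/measurable_EFinP; apply: measurable_funB => //.
  exact: superlevel_measurable.
have Glb t : t <= m -> G t = 1 by exact: superlevel_lb.
suff : (\int[lebesgue_measure]_(t in `]-oo, 0%R]) (G t - 1)%:E +
    \int[lebesgue_measure]_(t in `[0%R, +oo[) (G t)%:E =
    m%:E + \int[lebesgue_measure]_(t in `[m, +oo[) (G t)%:E)%E by [].
have [m0|m0] := leP m 0.
  rewrite (ge0_integral_itvU (a := BLeft m) (x := BLeft 0) (b := +oo%O) _ _ mG)
    ?bnd_simp//.
  suff -> : (\int[lebesgue_measure]_(t in `]-oo, 0%R]) (G t - 1)%:E =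
    m%:E + \int[lebesgue_measure]_(t in `[m, 0%R[) (G t)%:E)%E.
    exact: (esym (addeA _ _ _)).
   have -> : (\int[lebesgue_measure]_(t in `[m, 0%R[) (G t)%:E =
      \int[lebesgue_measure]_(t in `[m, 0%R]) (G t)%:E)%E.
    by apply: integral_itv_bndo_bndc; exact: measurable_funTS.
  under eq_integral do rewrite -opprB EFinN.
  rewrite integral_ge0N; last by move=> t _; rewrite lee_fin.
  rewrite (ge0_integral_itvU (a := -oo%O) (x := BLeft m) (b := BRight 0) _ _ mG1)
    ?bnd_simp//.
  rewrite integral0_eq ?add0e; last first.
    by move=> t /=; rewrite in_itv /= => tm; rewrite Glb ?subrr// ltW.
  (* On [[m, 0]] the integrals of [1 - G] and [G] are nonnegative and add up to [- m]; hence both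
     are finite and can be subtracted. *)
  have /esym : (\int[lebesgue_measure]_(t in `[m, 0%R]) 1%:E = (- m)%:E)%E.
    rewrite integral_cst//= mul1e lebesgue_measure_itv /= lte_fin.
    case: ltP => [_|m0']; first by rewrite -EFinB sub0r.
    by congr EFin; lra.
  rewrite (_ : (fun _ => _) = fun t => ((1 - G t)%:E + (G t)%:E)%E); last first.
    by apply/funext => t; rewrite -EFinD subrK.
  rewrite ge0_integralD//; [|by move=> t _; rewrite lee_fin|exact: measurable_funTS..].
  set I := integral _ _ _; set J := integral _ _ _ => IJ.
  have I0 : (0 <= I)%E by apply: integral_ge0 => t _; rewrite lee_fin.
  have J0 : (0 <= J)%E by exact: integral_ge0.
  case: I I0 IJ => [i| |]; case: J J0 => [j| |] //= _ _ [ij].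
  by rewrite -EFinD; congr EFin; lra.
rewrite integral0_eq ?add0e; last first.
  by move=> t /=; rewrite in_itv /= => t0; rewrite Glb ?subrr// (le_trans t0)// ltW.
rewrite (ge0_integral_itvU (a := BLeft 0) (x := BLeft m) (b := +oo%O) _ _ mG)
  ?bnd_simp ?ltW//.
suff : (\int[lebesgue_measure]_(t in `[0%R, m[) (G t)%:E = m%:E)%E by move=> ->.
rewrite (eq_integral (cst 1%:E)); last first.
  by move=> t; rewrite inE /= in_itv/= => /andP[_ tm]; rewrite Glb// ltW.
by rewrite integral_cst//= mul1e lebesgue_measure_itv /= lte_fin m0 sube0.
Qed.

(** Substitute [t = c * s + k] in the form with lower bound [c * m + k]; since [c > 0], the
    superlevel sets are unchanged. *)
Lemma choquet_affine xi c k m : measurable_fun setT xi ->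
  (forall w, m <= xi w) -> 0 < c ->
  choquet V (fun w => c * xi w + k) = (c%:E * choquet V xi + k%:E)%E.
Proof.
move=> mxi lb c0.
have mcxi : measurable_fun setT (fun w => c * xi w + k).
  exact: measurableT_comp (measurable_affine c k) mxi.
rewrite (choquet_lb mcxi (m := c * m + k)); last first.
  by move=> w; rewrite lerD2r ler_pM2l.
rewrite (choquet_lb mxi lb).
rewrite (ge0_integral_affine k c0)//; last 2 first.
- apply: measurable_funTS; apply/measurable_EFinP.
  exact: superlevel_measurable.
- by move=> t; rewrite lee_fin superlevel_ge0.
rewrite (_ : _ @^-1` _ = `[m, +oo[%classic); last first.
  by apply/seteqP; split=> s /=; rewrite !in_itv /= !andbT lerD2r ler_pM2l.
have -> : (\int[lebesgue_measure]_(s in `[m, +oo[)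
      (V [set w | (c * s + k <= c * xi w + k)%R])%:E =
    \int[lebesgue_measure]_(s in `[m, +oo[) (V [set w | (s <= xi w)%R])%:E)%E.
  apply: eq_integral => s _; congr (V _)%:E.
  by apply/seteqP; split=> w /=; rewrite lerD2r ler_pM2l.
set I := integral _ _ _; clearbody I.
by rewrite muleDr ?fin_num_adde_defr// addeAC -EFinM -EFinD.
Qed.

(** Comonotone additivity in its simplest case: the superlevel set at [t] is [B] for [0 < t <= 1],
    [A] for [1 < t <= 2], and empty for [t > 2]. *)
Lemma choquet_chain A B : measurable A -> measurable B -> A `<=` B ->
  choquet V (fun w => \1_A w + \1_B w) = (V A + V B)%:E.
Proof.
move=> mA mB AB.
have mxi : measurable_fun setT (fun w => \1_A w + \1_B w : R).
  by apply: measurable_funD; exact: measurable_indic.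
rewrite (choquet_lb mxi (m := 0)); last by move=> w; rewrite addr_ge0.
rewrite add0e; pose G (t : R) := V [set w | t <= \1_A w + \1_B w].
change (\int[lebesgue_measure]_(t in `[0%R, +oo[) (G t)%:E = (V A + V B)%:E)%E.
have mG : measurable_fun setT (fun t => (G t)%:E).
  by apply/measurable_EFinP; exact: superlevel_measurable.
have G0 t : (0 <= (G t)%:E)%E by rewrite lee_fin; exact: superlevel_ge0.
(* Superlevel sets are closed conditions, so the pieces with a constant level set are open on the
   left; the endpoint [0] is dropped to match. *)
have -> : (\int[lebesgue_measure]_(t in `[0%R, +oo[) (G t)%:E =
    \int[lebesgue_measure]_(t in `]0%R, +oo[) (G t)%:E)%E.
  by apply/esym/integral_itv_obnd_cbnd; exact: measurable_funTS.
rewrite (ge0_integral_itvU (a := BRight 0) (x := BRight 1) (b := +oo%O) _ _ mG)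
  ?bnd_simp//.
rewrite (ge0_integral_itvU (a := BRight 1) (x := BRight 2) (b := +oo%O) _ _ mG)
  ?bnd_simp ?ler1n//.
have cst_piece (a b v : R) : a <= b -> {in `]a, b], forall t, G t = v} ->
    (\int[lebesgue_measure]_(t in `]a, b]) (G t)%:E = (v * (b - a))%:E)%E.
  move=> ab Gv; rewrite (eq_integral (cst v%:E)); last first.
    by move=> t; rewrite inE /= => /Gv ->.
  rewrite integral_cst//= lebesgue_measure_itv /= lte_fin.
  case: ltP => [_|ba]; first by rewrite EFinM.
  by rewrite mule0; congr EFin; rewrite (@le_anti _ _ a b) ?ab// subrr mulr0.
have level (t : R) (w : Omega) : 
    (t <= \1_A w + \1_B w) =
    [|| t <= 0, (t <= 1) && (w \in B) | (t <= 2) && (w \in A)].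
  rewrite !indicE; have [wA|wA] := boolP (w \in A).
    rewrite (mem_set (AB w (set_mem wA))) /= andbT andbT -[(1 + 1)%R]/(2%:R).
    by apply/idP/or3P => [t2|[] t2]; [apply: Or33|..]; lra.
  rewrite andbF orbF add0r; case: (w \in B) => /=; rewrite ?andbT ?andbF ?orbF//.
  by apply/idP/orP => [t1|[] t1]; [right|..]; lra.
rewrite (cst_piece 0 1 (V B))//; last first.
  move=> t; rewrite in_itv /= => /andP[t0 t1]; congr V.
  apply/seteqP; split => w /=; rewrite level leNgt t0 t1 /=.
    by move=> /orP[/set_mem//|/andP[_ /set_mem /AB]].
  by move=> wB; rewrite mem_set.
rewrite (cst_piece 1 2 (V A)) ?ler1n//; last first.
  move=> t; rewrite in_itv /= => /andP[t1 t2]; congr V.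
  apply/seteqP; split => w /=; rewrite level t2 !leNgt t1 (lt_trans _ t1)//=.
    by move=> /set_mem.
  by move=> wA; rewrite mem_set.
rewrite integral0_eq ?adde0; last first.
  move=> t /=; rewrite in_itv /= andbT => t2; congr EFin.
  rewrite -(capacity_set0 capV); congr V; apply/seteqP; split => w //=.
  by rewrite level !leNgt t2 (lt_trans _ t2)// (lt_trans _ t2)// ltr1n.
by rewrite -EFinD; congr EFin; ring.
Qed.

Lemma choquet_indic B : measurable B -> choquet V \1_B = (V B)%:E.
Proof.
move=> mB; rewrite -[V B]add0r -(capacity_set0 capV) -choquet_chain//.
by congr choquet; apply/funext => w; rewrite indic0 add0r.
Qed.

Lemma le_choquet xi xi' m : measurable_fun setT xi -> measurable_fun setT xi' ->
  (forall w, m <= xi w) -> (forall w, xi w <= xi' w) ->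
  (choquet V xi <= choquet V xi')%E.
Proof.
move=> mxi mxi' lb le_xi; rewrite (choquet_lb mxi lb).
rewrite (choquet_lb mxi' (m := m)); last by move=> w; exact: le_trans (le_xi w).
apply: leeD2l; apply: ge0_le_integral => //.
- by move=> t _; rewrite lee_fin superlevel_ge0.
- by apply: measurable_funTS; apply/measurable_EFinP; exact: superlevel_measurable.
- by apply: measurable_funTS; apply/measurable_EFinP; exact: superlevel_measurable.
- move=> t _; rewrite lee_fin; apply: (capacity_mono capV).
  + exact: measurable_superlevel.
  + exact: measurable_superlevel.
  + by move=> w /= /le_trans; exact.
Qed.

(** Serves to compare random variables that differ pointwise, even on events of positive
    capacity. *)
Lemma eq_choquet xi xi' :
  (forall t : R, V [set w | t <= xi w] = V [set w | t <= xi' w]) ->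
  choquet V xi = choquet V xi'.
Proof.
move=> eqV; apply: (congr2 (@GRing.add _));
  by apply: eq_integral => t _; rewrite eqV.
Qed.

End choquet_integral.

(** * Combinations of solutions, and slopes of solutions at small times *)

Lemma is_derive_lincomb (R : realType) (v v1 v2 : R -> R) (c1 c2 k x : R) :
  derivable v1 x 1 -> derivable v2 x 1 ->
  (\forall y \near x, v y = c1 * v1 y + c2 * v2 y + k) ->
  is_derive x 1 v (c1 * derive1 v1 x + c2 * derive1 v2 x).
Proof.
move=> /derivableP d1 /derivableP d2 vE.
have dv : is_derive x 1 (c1 \*: v1 + c2 \*: v2 + cst k)
    (c1 * derive1 v1 x + c2 * derive1 v2 x).
  by apply: is_derive_eq; rewrite addr0 !derive1E.
by apply: near_eq_is_derive dv; apply: filterS vE => y ->.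
Qed.

Lemma derive1_lincomb (R : realType) (v v1 v2 : R -> R) (c1 c2 k x : R) :
  derivable v1 x 1 -> derivable v2 x 1 ->
  (\forall y \near x, v y = c1 * v1 y + c2 * v2 y + k) ->
  derive1 v x = c1 * derive1 v1 x + c2 * derive1 v2 x.
Proof.
by move=> d1 d2 vE; rewrite derive1E; have [_] := is_derive_lincomb d1 d2 vE.
Qed.

Section generator.
Context (R : realType) (g : R -> R -> R) (T : R).
Implicit Types (u : R -> R -> R) (f : R -> R).

(** The terms in [dt] and [dxx] are linear and cancel, so that only a relation on [g] is left. The
    strict bound [t < T] makes the assumed identity valid on a neighbourhood of [t], as the time
    derivative requires. *)
Lemma pde_superposition f f1 f2 u u1 u2 (c1 c2 k t x : R) :
  pde_solution g f u -> pde_solution g f1 u1 -> pde_solution g f2 u2 ->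
  (forall s y, 0 <= s <= T -> u s y = c1 * u1 s y + c2 * u2 s y + k) ->
  0 < t < T ->
  g (u t x) (c1 * dx u1 t x + c2 * dx u2 t x) =
  c1 * g (u1 t x) (dx u1 t x) + c2 * g (u2 t x) (dx u2 t x).
Proof.
move=> su su1 su2 uE /andP[t0 tT].
have [_ r1 p1 _ _ _] := su1; have [_ r2 p2 _ _ _] := su2.
have [_ _ p _ _ _] := su.
have uEt y : u t y = c1 * u1 t y + c2 * u2 t y + k by rewrite uE// !ltW.
have dxE y : dx u t y = c1 * dx u1 t y + c2 * dx u2 t y.
  have [_ + _ _ _ _ _] := r1 t y t0; have [_ + _ _ _ _ _] := r2 t y t0.
  by move=> d2 d1; apply: (derive1_lincomb d1 d2 (k := k)); near=> z.
have dxxE : dxx u t x = c1 * dxx u1 t x + c2 * dxx u2 t x.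
  have [_ _ + _ _ _ _] := r1 t x t0; have [_ _ + _ _ _ _] := r2 t x t0.
  move=> d2 d1; apply: (derive1_lincomb d1 d2 (k := 0)); near=> z.
  by rewrite addr0; exact: dxE.
have dtE : dt u t x = c1 * dt u1 t x + c2 * dt u2 t x.
  have [+ _ _ _ _ _ _] := r1 t x t0; have [+ _ _ _ _ _ _] := r2 t x t0.
  move=> d2 d1; apply: (derive1_lincomb d1 d2 (k := k)); near=> s.
  apply: uE; apply/andP; split; near: s.
    by near=> s; apply: ltW; near: s; exact: lt_nbhsr.
  by near=> s; apply: ltW; near: s; exact: lt_nbhsl.
have := p t x t0; rewrite dtE dxxE dxE p1// p2//.
move: (dxx u1 t x) (dxx u2 t x) (g (u1 t x) _) (g (u2 t x) _) (g (u t x) _).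
move=> a1 a2 b1 b2 b bE; apply: (addrI (2^-1 * (c1 * a1 + c2 * a2))).
by rewrite -bE; ring.
Unshelve. all: by end_near.
Qed.

Lemma sol_cvg0 f u (x : R) : pde_solution g f u -> {for x, continuous f} ->
  u t x @[t --> 0^'+] --> f x.
Proof.
move=> su cf; apply: (cvg_comp (fun t : R => (t, x)) _ _ (sol_continuous0 su cf)).
move=> Q [[U1 U2] /= [U10 U2x] sub]; near=> t; apply: sub => /=.
  split; last exact: nbhs_singleton. by near: t; apply: cvg_within; exact: U10.
by apply: ltW; near: t; exact: nbhs_right_gt.
Unshelve. all: by end_near.
Qed.

(** For small [t] the increment of [u t] from [x1] to [x2] has the sign of [f x2 - f x1], and the
    mean value theorem turns it into a slope. *)
Lemma initial_slope f u (x1 x2 : R) : pde_solution g f u -> x1 < x2 ->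
  {for x1, continuous f} -> {for x2, continuous f} -> f x1 != f x2 ->
  exists2 e, 0 < e & forall t, 0 < t < e ->
    exists2 x, x1 < x < x2 & 0 < (f x2 - f x1) * dx u t x.
Proof.
move=> su x12 cf1 cf2 f12; have reg := sol_regular su.
(* Half the gap: two errors below [del] cannot reverse the sign of the increment. *)
pose del := `|f x2 - f x1| / 2.
have del0 : 0 < del by rewrite divr_gt0// normr_gt0 subr_eq0 eq_sym.
have : \forall t \near 0^'+, `|f x1 - u t x1| < del /\ `|f x2 - u t x2| < del.
  near=> t; split; near: t.
    by have /cvgrPdist_lt/(_ _ del0) := sol_cvg0 su cf1.
  by have /cvgrPdist_lt/(_ _ del0) := sol_cvg0 su cf2.
move=> [e /= e0 close]; exists e => // t /andP[t0 te].
have [] := close t; first by rewrite /= sub0r normrN gtr0_norm.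
  exact: t0.
move=> c1 c2.
have [x x_in uE] : exists2 c, c \in `]x1, x2[ &
    u t x2 - u t x1 = dx u t c * (x2 - x1).
  apply: MVT => //.
    move=> x _; rewrite /dx derive1E; apply: derivableP.
    exact: C12_derivable_x (reg t x t0).
  apply: derivable_within_continuous => x _.
  exact: C12_derivable_x (reg t x t0).
exists x; first by rewrite in_itv in x_in.
rewrite -(pmulr_lgt0 _ (_ : 0 < x2 - x1)) ?subr_gt0// -mulrA -uE.
move: c1 c2; rewrite /del; case: (ltgtP (f x1) (f x2)) f12 => // f12 _.
  rewrite [`|f x2 - f x1|]gtr0_norm ?subr_gt0// !ltr_norml => /andP[a1 a2] /andP[a3 a4].
  by rewrite mulr_gt0//; lra.
rewrite [`|f x2 - f x1|]ltr0_norm ?subr_lt0// !ltr_norml => /andP[a1 a2] /andP[a3 a4].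
by rewrite nmulr_rgt0//; lra.
Unshelve. all: by end_near.
Qed.

End generator.

(** * Exponentials and the scalar linear differential equation *)

Lemma is_derive_expR_scale (R : realType) (c x : R) :
  is_derive x 1 (fun y => expR (c * y)) (c * expR (c * x)).
Proof.
have dc : is_derive x 1 (fun y : R => c * y) c.
  by apply: is_derive_eq; rewrite [LHS]scaler1.
have := is_derive1_comp (is_derive_expR (c * x)) dc.
by rewrite mulrC.
Qed.

(** With the integrating factor [expR (- kappa * s)], the product [phi] has zero derivative on []0,
    e[], hence is constant there; its limit at [0] from the right identifies the constant. *)
Lemma cvg0_linear_ode (R : realType) (w : R -> R) (kappa e w0 : R) :
  (forall t, 0 < t < e -> derivable w t 1 /\ derive1 w t = kappa * w t :> R) ->
  w t @[t --> 0^'+] --> w0 ->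
  forall t, 0 < t < e -> w t = expR (kappa * t) * w0.
Proof.
move=> ode w_w0 t /andP[t0 te].
pose phi s := expR (- kappa * s) * w s.
have dphi s : 0 < s < e -> is_derive s 1 phi 0.
  move=> /ode [/derivableP]; rewrite derive1E => dw wE.
  have := is_deriveM (is_derive_expR_scale (- kappa) s) dw.
  by move=> /is_derive_eq; apply; rewrite wE /GRing.scale /=; ring.
have phi_cst s : 0 < s < t -> phi s = phi t.
  move=> /andP[s0 st].
  have inoo r : s <= r <= t -> 0 < r < e.
    by move=> /andP[sr rt]; rewrite (lt_le_trans s0)// (le_lt_trans rt).
  have [||r _ /eqP] := @MVT R phi (fun=> 0) s t st.
  - move=> r; rewrite in_itv /= => /andP[sr rt]; apply: dphi.
    by rewrite inoo// !ltW.
  - apply: derivable_within_continuous => r; rewrite in_itv /= => /inoo /dphi.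
    by [].
  - by rewrite mul0r subr_eq0 => /eqP.
have : phi s @[s --> 0^'+] --> phi t.
  apply: cvg_near_cst; near=> s; apply: phi_cst; apply/andP; split; near: s.
    exact: nbhs_right_gt.
  exact: nbhs_right_lt.
have : phi s @[s --> 0^'+] --> expR (- kappa * 0) * w0.
  apply: cvgM w_w0; apply: cvg_at_right_filter.
  have [dexp _] := is_derive_expR_scale (- kappa) 0.
  by move/derivable1_diffP/differentiable_continuous : dexp.
move=> c1 c2; have := cvg_unique _ c1 c2.
rewrite mulr0 expR0 mul1r => ->//.
by rewrite /phi mulrA -expRD mulNr subrr expR0 mul1r.
Unshelve. all: by end_near.
Qed.

(** * Boundedness of the data used, and continuity of indicators away from their jumps *)

Lemma bounded_fun_lb (R : realType) (f : R -> R) :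
  bounded_fun f -> exists m, forall x, m <= f x.
Proof.
move=> [M [_ /(_ (M + 1))]]; rewrite ltrDl ltr01 => /(_ isT) bM.
exists (- (M + 1)) => x; have /= := bM x I; by rewrite ler_norml => /andP[].
Qed.

Lemma bounded_fun_affine (R : realType) (f : R -> R) (c k : R) :
  bounded_fun f -> bounded_fun (fun x => c * f x + k).
Proof.
move=> [M [_ /(_ (M + 1))]]; rewrite ltrDl ltr01 => /(_ isT) bM.
exists (`|c| * (M + 1) + `|k|); split; first exact: num_real.
move=> M' /ltW MM' x _; apply: le_trans MM'.
by rewrite (le_trans (ler_normD _ _))// lerD2r normrM ler_wpM2l// bM.
Qed.

Lemma bounded_fun_indic (R : realType) (A : set R) :
  bounded_fun (\1_A : R -> R).
Proof.
exists 1; split => // M M1 x _; apply: le_trans (ltW M1).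
by rewrite /= indicE ger0_norm ?ler0n// lern1 leq_b1.
Qed.

Lemma bounded_fun_indicD (R : realType) (A B : set R) :
  bounded_fun (fun x => \1_A x + \1_B x : R).
Proof.
exists 2; split => // M M2 x _; apply: le_trans (ltW M2).
rewrite /= !indicE ger0_norm ?addr_ge0// -natrD ler_nat.
by case: (x \in A); case: (x \in B).
Qed.

Lemma continuous_near_cst (R : realType) (f : R -> R) (c x : R) :
  (\forall y \near x, f y = c) -> {for x, continuous f}.
Proof.
move=> fc; have fx : f x = c := nbhs_singleton fc.
by change (f y @[y --> x] --> f x); rewrite fx; exact: cvg_near_cst.
Qed.

Lemma continuous_indic_in (R : realType) (A : set R) x :
  nbhs x A -> {for x, continuous (\1_A : R -> R)}.
Proof.
move=> nA; apply: (continuous_near_cst (c := 1)).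
by apply: filterS nA => y Ay; rewrite indicE mem_set.
Qed.

Lemma continuous_indic_out (R : realType) (A : set R) x :
  nbhs x (~` A) -> {for x, continuous (\1_A : R -> R)}.
Proof.
move=> nA; apply: (continuous_near_cst (c := 0)).
by apply: filterS nA => y Ay; rewrite indicE memNset.
Qed.

(** * Consequences for [g] of a representation of all solutions by one capacity *)

Section representation.
Context (R : realType) (d : measure_display) (Omega : measurableType d).
Context (T : R) (W : R -> Omega -> R) (g : R -> R -> R).
Context (u : (R -> R) -> R -> R -> R) (V : set Omega -> R).
Hypothesis T_gt0 : 0 < T.
Hypothesis mW : forall s, 0 <= s <= T -> measurable_fun setT (W s).
Hypothesis g0 : forall y, g y 0 = 0.
Hypothesis u_solution : forall f : R -> R, measurable_fun [set: R] f ->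
  bounded_fun f -> pde_solution g f (u f).
Hypothesis capV : capacity V.
Hypothesis rep : forall f : R -> R, measurable_fun [set: R] f ->
  bounded_fun f -> forall t x : R, 0 <= t <= T ->
    (u f t x)%:E = choquet V (fun w => f (W t w + x)).
Implicit Types (f : R -> R) (A B : set R).

Let measurable_shift t x f : 0 <= t <= T -> measurable_fun setT f ->
  measurable_fun setT (fun w => f (W t w + x)).
Proof.
move=> tT mf; apply: measurableT_comp mf _.
by apply: measurable_funD => //; exact: mW.
Qed.

Lemma u_affine f c k t x : measurable_fun setT f -> bounded_fun f -> 0 < c ->
  0 <= t <= T -> u (fun y => c * f y + k) t x = c * u f t x + k.
Proof.
move=> mf bf c0 tT; apply: EFin_inj.
have mcf : measurable_fun setT (fun y => c * f y + k).
  exact: measurableT_comp (measurable_affine c k) mf.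
rewrite rep//; last exact: bounded_fun_affine.
have [m lb] := bounded_fun_lb bf.
rewrite (choquet_affine capV k (m := m) (measurable_shift x tT mf))//.
by rewrite -rep// EFinD EFinM.
Qed.

Lemma measurable_hit A t x : measurable A -> 0 <= t <= T ->
  measurable [set w | A (W t w + x)].
Proof.
move=> mA tT; rewrite -[X in measurable X]setTI.
exact: (measurable_shift x tT (@measurable_id _ _ setT)).
Qed.

Let indic_hit A t x w : \1_A (W t w + x) = \1_[set w | A (W t w + x)] w :> R.
Proof.
by rewrite !indicE; congr (nat_of_bool _)%:R; apply/idP/idP; rewrite !inE.
Qed.

Lemma u_indic A t x : measurable A -> 0 <= t <= T ->
  u \1_A t x = V [set w | A (W t w + x)].
Proof.
move=> mA tT; apply: EFin_inj; rewrite rep//; last exact: bounded_fun_indic.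
rewrite -(choquet_indic capV); last exact: measurable_hit.
by congr choquet; apply/funext => w; rewrite indic_hit.
Qed.

Lemma u_chain A B t x : measurable A -> measurable B -> A `<=` B ->
  0 <= t <= T ->
  u (fun y => \1_A y + \1_B y) t x = u \1_A t x + u \1_B t x.
Proof.
move=> mA mB AB tT; apply: EFin_inj; rewrite rep//; last 2 first.
- by apply: measurable_funD; exact: measurable_indic.
- exact: bounded_fun_indicD.
rewrite !u_indic// -(choquet_chain capV); last 3 first.
- exact: measurable_hit.
- exact: measurable_hit.
- by move=> w; exact: AB.
by congr choquet; apply/funext => w; rewrite !indic_hit.
Qed.

Let solves_indic A : measurable A -> pde_solution g \1_A (u \1_A).
Proof.
move=> mA; apply: u_solution; last exact: bounded_fun_indic.
exact: measurable_indic.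
Qed.

(** The solution for the datum [c * f + k] is [c * u f + k]; comparing the two equations gives
    homogeneity of [g], and the freedom in [k] removes the dependence on the first argument. *)
Lemma g_ray f t x y c : measurable_fun setT f -> bounded_fun f ->
  0 < t < T -> 0 < c ->
  g y (c * dx (u f) t x) = c * g (u f t x) (dx (u f) t x).
Proof.
move=> mf bf tT c0; pose k := y - c * u f t x.
have mcf : measurable_fun setT (fun y => c * f y + k).
  exact: measurableT_comp (measurable_affine c k) mf.
have sf := u_solution mf bf.
have scf := u_solution mcf (bounded_fun_affine c k bf).
have uE s z : 0 <= s <= T ->
    u (fun y => c * f y + k) s z = c * u f s z + 0 * u f s z + k.
  by move=> sT; rewrite mul0r addr0 u_affine.
have := pde_superposition x scf sf sf uE tT.
rewrite !mul0r !addr0 uE; last by move: tT => /andP[/ltW-> /ltW->].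
by rewrite mul0r addr0 addrC subrK.
Qed.

(** Apply [g_ray] with [c] the ratio of [z] to the slope of [u f], positive because both have the
    same sign. *)
Lemma g_half_line f t x y z : measurable_fun setT f -> bounded_fun f ->
  0 < t < T -> 0 < z * dx (u f) t x ->
  g y z = g (u f t x) (dx (u f) t x) / dx (u f) t x * z.
Proof.
move=> mf bf tT zp.
have p0 : dx (u f) t x != 0 by apply: contraTneq zp => ->; rewrite mulr0 ltxx.
have c0 : 0 < z / dx (u f) t x.
  rewrite -(pmulr_lgt0 _ (_ : 0 < dx (u f) t x ^+ 2)) ?exprn_even_gt0//.
  by rewrite expr2 mulrA divfK.
have := g_ray x y mf bf tT c0; rewrite divfK// => ->.
by field.
Qed.

(** * Reduction to a generator that is linear on each half-line *)

Let bump := \1_(`[0%R, 2%R] : set R) : R -> R.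

(** The datum rises from [-1] to [1] and falls from [1] to [3], three points away from its jumps at
    [0] and [2]; [initial_slope] applies to both intervals. *)
Lemma bump_slopes : exists2 e, 0 < e <= T & forall t, 0 < t < e ->
  (exists x, 0 < dx (u bump) t x) /\
  (exists2 x, x < 3 & dx (u bump) t x < 0).
Proof.
have sb : pde_solution g bump (u bump) by exact: solves_indic.
have bump_out x : x < 0 \/ 2 < x -> {for x, continuous bump} /\ bump x = 0.
  move=> x02; split; last first.
    by rewrite /bump indicE memNset//= in_itv /=; case: x02; lra.
  apply: continuous_indic_out; case: x02 => x02; near=> y => /=; rewrite in_itv /=.
    suff : y < 0 by lra.
    by near: y; exact: lt_nbhsl.
  suff : 2 < y by lra.
  by near: y; exact: lt_nbhsr.
have [c1 b1] : {for 1, continuous bump} /\ bump 1 = 1.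
  split; last by rewrite /bump indicE mem_set//= in_itv /=; lra.
  apply: continuous_indic_in; near=> y => /=; rewrite in_itv /=; apply/andP; split.
    by apply: ltW; near: y; exact: lt_nbhsr.
  by apply: ltW; near: y; apply: lt_nbhsl; lra.
have [|cN1 bN1] := bump_out (-1); first by left; lra.
have [|c3 b3] := bump_out 3; first by right; lra.
have [||e1 e10 up] := initial_slope sb _ cN1 c1.
- lra.
- by rewrite b1 bN1 eq_sym oner_neq0.
have [||e2 e20 down] := initial_slope sb _ c1 c3.
- lra.
- by rewrite b1 b3 oner_neq0.
exists (Num.min (Num.min e1 e2) T).
  by rewrite !lt_min e10 e20 T_gt0 ge_min lexx orbT.
move=> t /andP[t0]; rewrite !lt_min => /andP[/andP[te1 te2] tT]; split.
  have [|x _] := up t; first by rewrite t0.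
  by rewrite b1 bN1 subr0 mul1r; exists x.
have [|x /andP[_ x3]] := down t; first by rewrite t0.
by rewrite b3 b1 sub0r mulN1r oppr_gt0; exists x.
Unshelve. all: by end_near.
Qed.

(** One point with positive slope and one with negative slope of [u bump], at the common time
    [e / 2], determine [g] on the two half-lines. *)
Lemma g_half_lines :
  exists a b, forall y z, g y z = (if 0 <= z then a else b) * z.
Proof.
have [e /andP[e0 eT] slopes] := bump_slopes.
have e2 : 0 < e / 2 < e by lra.
have [[x1 p1] [x2 _ p2]] := slopes _ e2.
have e2T : 0 < e / 2 < T by lra.
have mb : measurable_fun setT bump by exact: measurable_indic.
have bb : bounded_fun bump by exact: bounded_fun_indic.
exists (g (u bump (e / 2) x1) (dx (u bump) (e / 2) x1) / dx (u bump) (e / 2) x1).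
exists (g (u bump (e / 2) x2) (dx (u bump) (e / 2) x2) / dx (u bump) (e / 2) x2).
move=> y z; case: (ltgtP 0 z) => [z0|z0|<-]; last by rewrite g0 mulr0.
- by rewrite (g_half_line y mb bb e2T (mulr_gt0 z0 p1)).
- by apply: g_half_line => //; rewrite nmulr_rgt0.
Qed.

(** Let [x < 3] be a point where [u bump t] has negative slope. Then no ray containing [[0, 2]] can
    have positive slope at [x]. Translating rays, [H] cannot increase beyond [3]; as it tends to [1]
    and stays below [1], it equals [1] at [3]. *)
Lemma hit_full (a b : R) :
  (forall y z, g y z = (if 0 <= z then a else b) * z) -> a != b ->
  exists2 e, 0 < e <= T & forall t, 0 < t < e ->
    V [set w | 0 <= W t w + 3] = 1.
Proof.
move=> gE ab; have [e /andP[e0 eT] slopes] := bump_slopes.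
exists e; first by rewrite e0.
move=> t te; have [_ [x x3 q0]] := slopes t te.
have tT : 0 < t < T by lra.
have tT' : 0 <= t <= T by lra.
pose H y := V [set w | 0 <= W t w + y].
pose ray (s : R) := `[- s, +oo[%classic : set R.
have mray s : measurable (ray s) by exact: measurable_itv.
have uray s y : u \1_(ray s) t y = H (y + s).
  rewrite u_indic//; congr V; apply/seteqP.
  by split => w; rewrite /ray /= in_itv /= andbT; lra.
have dray s : 0 <= s -> dx (u \1_(ray s)) t x <= 0.
  move=> s0; rewrite leNgt; apply/negP => p0.
  have bs : `[0, 2]%classic `<=` ray s.
    by move=> y; rewrite /ray /= !in_itv /=; lra.
  have sbr : pde_solution g (fun y => bump y + \1_(ray s) y)
      (u (fun y => bump y + \1_(ray s) y)).
    apply: u_solution; last exact: bounded_fun_indicD.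
    by apply: measurable_funD; exact: measurable_indic.
  have uE r y : 0 <= r <= T -> u (fun y => bump y + \1_(ray s) y) r y =
      1 * u bump r y + 1 * u \1_(ray s) r y + 0.
    by move=> rT; rewrite !mul1r addr0 u_chain.
  have sb : pde_solution g bump (u bump) by exact: solves_indic.
  have := pde_superposition x sbr sb (solves_indic (mray s)) uE tT.
  rewrite !mul1r !gE (ltW p0) (lt_geF q0) => gadd.
  (* Whatever the sign of the total slope, exactly one of the two summands has its coefficient
     changed, so [a - b] times a nonzero slope vanishes. *)
  move/negP: ab; apply; rewrite -subr_eq0; move: gadd; case: ifP => _ gadd.
    have /eqP : (a - b) * dx (u bump) t x = 0 by lra.
    by rewrite mulf_eq0 (lt_eqF q0) orbF.
  have /eqP : (a - b) * dx (u \1_(ray s)) t x = 0 by lra.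
  by rewrite mulf_eq0 (gt_eqF p0) orbF.
have mhit y : measurable [set w | 0 <= W t w + y].
  have := measurable_hit y (mray 0) tT'.
  congr measurable; apply/seteqP; split => w;
    by rewrite /ray /= in_itv /= oppr0 andbT.
have H1 y : H y <= 1 by have /andP[] := capacity_range capV (mhit y).
(* Continuity from below: the events [0 <= W t w + (3 + n)] increase to the whole space. *)
have H_cvg : H (3 + n%:R) @[n --> \oo] --> (1 : R).
  suff : H (3 + n%:R) @[n --> \oo] --> V setT by rewrite (capacity_setT capV).
  pose A (n : nat) := [set w | 0 <= W t w + (3 + n%:R)].
  have <- : \bigcup_n A n = setT.
    apply/seteqP; split => // w _; exists (Num.trunc `|W t w + 3|).+1 => //.
    have := truncnS_gt `|W t w + 3|; have := ler_norm (- (W t w + 3)).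
    by rewrite normrN /A /mkset; lra.
  apply: (@capacity_cont _ _ _ V capV A) => [n|m n mn]; first exact: mhit.
  by apply/subsetPset => w /= /le_trans; apply; rewrite !lerD2l ler_nat.
apply/eqP; rewrite eq_le H1 leNgt; apply/negP => H3.
have [n H3n] : exists n, H 3 < H (3 + n%:R).
  have /cvgrPdist_lt /(_ (1 - H 3)) := H_cvg.
  rewrite subr_gt0 => /(_ H3)[N _ /(_ N (leqnn N)) /= HN].
  by exists N; move: HN; rewrite ltr_norml; lra.
have HE : u \1_(ray 0) t = H by apply/funext => y; rewrite uray addr0.
have dH (y : R) : is_derive y 1 H (derive1 H y).
  rewrite derive1E; apply: derivableP; rewrite -HE.
  have /andP[t0 _] := tT.
  exact: C12_derivable_x (sol_regular (solves_indic (mray 0)) y t0).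
have n3 : 3 < 3 + n%:R :> R.
  rewrite ltrDl ltr0n lt0n; apply: contraTneq H3n => ->.
  by rewrite addr0 ltxx.
have cH : {within `[3, 3 + n%:R], continuous H}.
  by apply: derivable_within_continuous => y _; have [] := dH y.
have [c c3 Hc] := MVT n3 (fun y _ => dH y) cH.
move: c3; rewrite in_itv /= => /andP[c3 _].
(* The ray [[x - c, +oo[] translates [H] so that its slope at [c] appears at [x]; the shift is
   nonnegative since [x < 3 < c]. *)
have := dray (c - x); rewrite subr_ge0 (ltW (lt_trans x3 c3)) => /(_ isT).
rewrite leNgt => /negP; apply.
rewrite /dx (_ : u _ t = H \o (fun y => y + (c - x))); last first.
  by apply/funext => y; rewrite uray.
rewrite derive1E; have := is_derive1_comp (dH _) (is_derive_shift x 1 (c - x)).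
move=> /@derive_val ->; rewrite mulr1 /= addrC subrK ltNge.
apply: contraL H3n => Hc0; rewrite -leNgt -subr_le0 Hc.
by rewrite mulr_le0_ge0// addrAC subrr add0r.
Qed.

(** * Exponential data and their exact evolution far to the right *)

(** For [la > 0], the distribution function of the exponential law of rate [la]. On [[0, +oo[] a
    shift by [y >= 0] acts on its values as the affine map [v -> c * v + (1 - c)] with
    [c = expR (- la * y)], which Choquet integrals respect. *)
Let expdatum (la x : R) : R := if 0 <= x then 1 - expR (- la * x) else 0.

Let expdatum_nd la : 0 < la -> nondecreasing_fun (expdatum la).
Proof.
move=> la0 x y xy; rewrite /expdatum.
have [x0|x0] := leP 0 x.
  by rewrite (le_trans x0 xy) lerD2l lerN2 ler_expR ler_nM2l ?oppr_lt0.
case: ifP => // y0; rewrite subr_ge0 -expR0 ler_expR mulNr oppr_le0.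
by rewrite mulr_ge0// ltW.
Qed.

Let expdatum01 la x : 0 < la -> 0 <= expdatum la x <= 1.
Proof.
move=> la0; rewrite /expdatum; case: ifP => x0; last by rewrite lexx ler01.
rewrite subr_ge0 gerBl expR_ge0 andbT.
by rewrite -expR0 ler_expR mulNr oppr_le0 mulr_ge0// ltW.
Qed.

Let measurable_expdatum la : 0 < la -> measurable_fun setT (expdatum la).
Proof.
by move=> la0; apply: nondecreasing_measurable => //; exact: expdatum_nd.
Qed.

Let bounded_expdatum la : 0 < la -> bounded_fun (expdatum la).
Proof.
move=> la0; exists 1; split => // M M1 x _; apply: le_trans (ltW M1).
by have /andP[? ?] := expdatum01 x la0; rewrite /= ger0_norm.
Qed.

Let u_expdatum01 la t x : 0 < la -> 0 <= t <= T ->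
  0 <= u (expdatum la) t x <= 1.
Proof.
move=> la0 tT; have md := measurable_expdatum la0.
have f01 w : 0 <= expdatum la (W t w + x) <= 1 by exact: expdatum01.
have mf : measurable_fun setT (fun w => expdatum la (W t w + x)).
  exact: measurable_shift.
rewrite -!lee_fin rep//; last exact: bounded_expdatum.
(* The constants [0] and [1] are written as Choquet integrals of indicators, so that monotonicity
   gives both bounds. *)
have <- : choquet V \1_set0 = 0%:E by rewrite choquet_indic// (capacity_set0 capV).
have <- : choquet V \1_setT = 1%:E by rewrite choquet_indic// (capacity_setT capV).
apply/andP; split; apply: (le_choquet capV (m := 0)) => // w.
- by rewrite indic0; have /andP[] := f01 w.
- by have /andP[] := f01 w.
- by rewrite indicT; have /andP[] := f01 w.
Qed.

(** On the event [0 <= W t w + x] the shifted variable is an affine image of the unshifted one. The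
    event has capacity [1], but its complement need not have capacity [0], so the two variables are
    compared level by level. *)
Let u_expdatum_shift la t x y : 0 < la -> 0 <= t <= T -> 0 <= y ->
  V [set w | 0 <= W t w + x] = 1 ->
  1 - u (expdatum la) t (x + y) = expR (- la * y) * (1 - u (expdatum la) t x).
Proof.
move=> la0 tT y0 full; set c := expR (- la * y).
have md := measurable_expdatum la0; have bd := bounded_expdatum la0.
suff uE : u (expdatum la) t (x + y) = c * u (expdatum la) t x + (1 - c).
  by rewrite uE; ring.
have c0 : 0 < c by exact: expR_gt0.
have mxi z : measurable_fun setT (fun w => expdatum la (W t w + z)).
  exact: measurable_shift.
apply: EFin_inj; rewrite EFinD EFinM !rep//.
rewrite -(choquet_affine capV (1 - c) (m := 0) (mxi x))//; last first.
  by move=> w; have /andP[] := expdatum01 (W t w + x) la0.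
have mxi' : measurable_fun setT (fun w => c * expdatum la (W t w + x) + (1 - c)).
  exact: measurableT_comp (measurable_affine c (1 - c)) (mxi x).
have mfull : measurable [set w | 0 <= W t w + x].
  have := measurable_hit x (measurable_itv `[0%R, +oo[) tT.
  by congr measurable; apply/seteqP; split => w; rewrite /= in_itv /= andbT.
have yE : expdatum la y = 1 - c by rewrite /expdatum y0.
have onfull w : 0 <= W t w + x ->
    expdatum la (W t w + (x + y)) = c * expdatum la (W t w + x) + (1 - c).
  move=> wx; rewrite /expdatum addrA wx addr_ge0// mulrDr expRD -/c; ring.
have offfull w : W t w + x < 0 -> expdatum la (W t w + (x + y)) <= 1 - c.
  by move=> wx; rewrite -yE; apply: expdatum_nd => //; lra.
have offfull' w : W t w + x < 0 -> c * expdatum la (W t w + x) + (1 - c) = 1 - c.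
  by move=> wx; rewrite /expdatum leNgt wx mulr0 add0r.
(* For [s <= 1 - c] both superlevel sets contain the event of capacity [1]; for [s > 1 - c] both lie
   inside it, where the variables agree. *)
apply: eq_choquet => s; have [sc|sc] := leP s (1 - c).
- have one xi : measurable_fun setT xi ->
      (forall w, 0 <= W t w + x -> s <= xi w) -> V [set w | s <= xi w] = 1.
    move=> mx sub; apply/eqP; rewrite eq_le (superlevel_le1 capV)//= -full.
    by apply: (capacity_mono capV) => //; exact: measurable_superlevel.
  have cle w : 1 - c <= c * expdatum la (W t w + x) + (1 - c).
    rewrite lerDr mulr_ge0 ?(ltW c0)//.
    by have /andP[] := expdatum01 (W t w + x) la0.
  rewrite !one// => w wx; last by rewrite onfull// (le_trans sc).
  exact: le_trans (cle w).
- congr V; apply/seteqP; split => w /=; have [wx|wx] := leP 0 (W t w + x).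
  + by rewrite onfull.
  + move=> h; have := le_lt_trans (le_trans h (offfull _ wx)) sc.
    by rewrite ltxx.
  + by rewrite onfull.
  + by rewrite (offfull' _ wx) leNgt sc.
Qed.

(** For [x >= 3] the shift relation makes [1 - u t x] a multiple of [expR (- la * x)], so at the
    interior point [4] all space derivatives are explicit multiples of [w = 1 - u t 4]. The slope
    [la * w] is nonnegative, hence only [a] enters, and the equation becomes linear in [w], with
    initial value [expR (- la * 4)]. *)
Let expdatum_growth (a b la e : R) : 0 < la -> e <= T ->
  (forall y z, g y z = (if 0 <= z then a else b) * z) ->
  (forall t, 0 < t < e -> V [set w | 0 <= W t w + 3] = 1) ->
  forall t, 0 < t < e -> 1 - u (expdatum la) t 4 =
    expR ((2^-1 * la ^+ 2 - a * la) * t) * expR (- la * 4).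
Proof.
move=> la0 eT gE full.
have sd := u_solution (measurable_expdatum la0) (bounded_expdatum la0).
have E4 : expdatum la 4 = 1 - expR (- la * 4) by rewrite /expdatum ler0n.
have tT t : 0 < t < e -> 0 <= t <= T by lra.
apply: cvg0_linear_ode => [t te|]; last first.
  rewrite (_ : expR _ = 1 - expdatum la 4); last by rewrite E4; ring.
  apply: cvgB; first exact: cvg_cst.
  apply: sol_cvg0 sd _; apply: differentiable_continuous; apply/derivable1_diffP.
  have [dexp _] := is_derive_expR_scale (- la) 4.
  have [] // := is_derive_lincomb (v := expdatum la) dexp dexp
    (c1 := -1) (c2 := 0) (k := 1).
  near=> y; rewrite /expdatum ifT; first by ring.
  by apply: ltW; near: y; apply: lt_nbhsr; lra.
have t0 : 0 < t by lra.
(* The coefficient of [expR (- la * x)] in [u t x - 1], read off at [x = 3]. *)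
pose k := - (expR (la * 3) * (1 - u (expdatum la) t 3)).
have uE x : 3 <= x -> u (expdatum la) t x =
    k * expR (- la * x) + 0 * expR (- la * x) + 1.
  move=> x3; have := u_expdatum_shift la0 (tT _ te) (_ : 0 <= x - 3) (full _ te).
  rewrite subr_ge0 x3 subrKC => /(_ isT).
  rewrite (_ : - la * (x - 3) = - la * x + la * 3); last by ring.
  rewrite expRD /k; lra.
have dexp x : derivable (fun x => expR (- la * x)) x 1.
  by have [] := is_derive_expR_scale (- la) x.
have expE x : derive1 (fun x => expR (- la * x)) x = - la * expR (- la * x).
  by rewrite derive1E; have := is_derive_expR_scale (- la) x => /@derive_val.
have dxE x : 3 < x -> dx (u (expdatum la)) t x =
   (k * - la) * expR (- la * x) + 0 * expR (- la * x) + 0.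
  move=> x3; rewrite /dx (derive1_lincomb (dexp x) (dexp x) (c1 := k) (c2 := 0)
    (k := 1)).
    by rewrite expE; ring.
  by near=> y; apply: uE; apply: ltW; near: y; exact: lt_nbhsr.
have dxxE : dxx (u (expdatum la)) t 4 = k * la ^+ 2 * expR (- la * 4).
  rewrite /dxx /= (derive1_lincomb (dexp _) (dexp _) (c1 := k * - la) (c2 := 0)
    (k := 0)).
    by rewrite expE; ring.
  near=> y; apply: dxE; near: y.
  by apply: lt_nbhsr; lra.
set w := 1 - _.
have wE : w = - k * expR (- la * 4) by rewrite /w uE; [ring|lra].
have w0 : 0 <= w by rewrite subr_ge0; have /andP[] := u_expdatum01 4 la0 (tT _ te).
have dx4 : dx (u (expdatum la)) t 4 = la * w by rewrite dxE; [rewrite wE; ring|lra].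
have pde := sol_pde sd 4 t0.
have [dt4 _ _ _ _ _ _] := sol_regular sd 4 t0.
have wlin : \forall s \near t, 1 - u (expdatum la) s 4 =
    -1 * u (expdatum la) s 4 + 0 * u (expdatum la) s 4 + 1.
  by near=> s; ring.
have [dw] := is_derive_lincomb dt4 dt4 wlin.
rewrite -derive1E => ->; split => //; rewrite -/(dt _ t 4).
rewrite pde dxxE dx4 gE mulr_ge0 ?(ltW la0)// -/w wE; ring.
Unshelve. all: by end_near.
Qed.

(** As [u >= 0], the quantity [1 - u] is at most [1] at time [e / 2] and position [4], whereas its
    explicit exponent is positive once [la] is large. *)
Lemma no_kink (a b : R) :
  (forall y z, g y z = (if 0 <= z then a else b) * z) -> a = b.
Proof.
move=> gE; apply/eqP/negPn/negP => ab.
have [e /andP[e0 eT] full] := hit_full gE ab.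
(* Makes the exponent [(la^2 / 2 - a la) t - 4 la] positive at [t = e / 2]. *)
pose la := 2 * (`|a| + 8 / e + 1).
have la0 : 0 < la.
  by rewrite mulr_gt0// addr_gt0// ltr_pwDr ?normr_ge0// divr_gt0.
have e2 : 0 < e / 2 < e by lra.
have := expdatum_growth la0 eT gE full e2.
rewrite -expRD => wE.
have : 1 - u (expdatum la) (e / 2) 4 <= 1.
  have /andP[] : 0 <= u (expdatum la) (e / 2) 4 <= 1.
    by apply: u_expdatum01; lra.
  by rewrite gerBl.
rewrite {}wE -[leRHS]expR0 ler_expR leNgt => /negP; apply.
(* The summand [8 / e] in [la / 2], multiplied by [e / 2], cancels the [4] coming from the initial
   value. *)
have -> : (2^-1 * la ^+ 2 - a * la) * (e / 2) + - la * 4 =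
    la * ((`|a| - a + 1) * (e / 2)).
  by rewrite [in X in _ = X * _]/la /la; field; rewrite gt_eqF.
rewrite mulr_gt0// mulr_gt0//; last lra.
by have := ler_norm a; lra.
Qed.

End representation.

Unset Implicit Arguments.

Theorem theorem2 (R : realType) (d : measure_display)
    (Omega : measurableType d) (P : probability Omega R) (T : R)
    (W : R -> Omega -> R) (g : R -> R -> R)
    (u : (R -> R) -> R -> R -> R)
    (T_gt0 : 0 < T)
    (W_brownian : brownian_motion P T W)
    (F_generated : @measurable d Omega = natural_filtration W T)
    (gH1 : condH1 T (fun y z _ => g y z))
    (gH2 : condH2 T (fun y z _ => g y z))
    (gH3 : condH3 T (fun y z _ => g y z))
    (u_solution : forall f : R -> R, measurable_fun [set: R] f ->
       bounded_fun f -> pde_solution g f (u f))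
    (g_nonlinear : ~ linear_in_z g) :
  ~ exists V : set Omega -> R, capacity V /\
      forall f : R -> R, measurable_fun [set: R] f -> bounded_fun f ->
        forall t x : R, 0 <= t <= T ->
          (u f t x)%:E = choquet V (fun w => f (W t w + x)).
Proof.
move=> [V [capV rep]]; apply: g_nonlinear.
have mW := bm_measurable W_brownian.
have g0 y : g y 0 = 0 by apply: gH3 (_ : 0 <= 0 <= T); rewrite lexx ltW.
have [a [b gE]] := g_half_lines T_gt0 mW g0 u_solution capV rep.
have ab : a = b := no_kink T_gt0 mW u_solution capV rep gE.
have {}gE y z : g y z = b * z by rewrite gE ab if_same.
by move=> y c z1 z2; rewrite !gE /GRing.scale /=; ring.
Qed.
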